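(* Let $X$ be an S-separable Tychonoff space. Then: (1) every dense subspace of $X$ is S-separable; (2) every open subspace of $X$ is S-separable.
   Context: A space $X$ is S-separable if for every sequence $(Y_n)_{n\in\mathbb{N}}$ of dense subspaces of $X$ there exists a sequence $(F_n)_{n\in\mathbb{N}}$ such that each $F_n$ is a finite subset of $Y_n$ and for each finite collection $\mathcal{F}$ of nonempty open sets of $X$ there exists $n\in\mathbb{N}$ with $U\cap F_n\neq\emptyset$ for all $U\in\mathcal{F}$. *)

(* Defs.v *)
From HB Require Import structures.
From mathcomp Require Import all_boot all_order all_algebra.
From mathcomp Require Import all_classical all_reals all_analysis.

Set Implicit Arguments.
Unset Strict Implicit.
Unset Printing Implicit Defensive.

Local Open Scope classical_set_scope.

(* [completely_regular_space] separates points from closed sets through a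
   uniform structure; by [uniform_separatorP] this is the same as separation by
   a continuous function into [0, 1].  It does not include any separation of
   points. *)
Definition tychonoff_space (X : topologicalType) : Prop :=
  completely_regular_space X /\ hausdorff_space X.

Definition S_separable (X : topologicalType) : Prop :=
  forall Y : nat -> set X, (forall n, dense (Y n)) ->
  exists F : nat -> set X,
    (forall n, finite_set (F n) /\ F n `<=` Y n) /\
    (forall G : set (set X), finite_set G ->
       (forall U, G U -> open U /\ U !=set0) ->
       exists n, forall U, G U -> U `&` F n !=set0).

(* Main.v *)
Require Import Defs.
From HB Require Import structures.
From mathcomp Require Import all_boot all_order all_algebra.
From mathcomp Require Import all_classical all_reals all_analysis.

Set Implicit Arguments.
Unset Strict Implicit.
Unset Printing Implicit Defensive.

Local Open Scope classical_set_scope.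

(* Dense sets and open sets [A] both satisfy [A `<=` (closure A)°].  For such
   an [A], a dense set of the subspace [A] becomes dense in [X] once the
   exterior of [A] is added to it; testing the resulting finite sets against
   open sets contained in [(closure A)°] never sees the added points. *)

Lemma dense_setU_exterior (X : topologicalType) (A : set X)
    (Y : set (set_type A)) :
  dense Y -> dense (set_val @` Y `|` ~` closure A).
Proof.
move=> dY O [x Ox] Oop; have [clx|nclx] := pselect (closure A x); last first.
  by exists x; split => //; right.
have [a [Aa Oa]] := clx O (open_nbhs_nbhs (conj Oop Ox)).
have [||b [Ob Yb]] := dY (set_val @^-1` O).
- by exists (exist _ a (mem_set Aa)).
- by exists O.
- by exists (set_val b); split => //; left; exists b.
Qed.

Lemma S_separable_sub_interior_closure (X : topologicalType) (A : set X) :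
  A `<=` (closure A)° -> S_separable X -> S_separable (set_type A).
Proof.
move=> sA sepX Y dY.
have [F [FY FG]] := sepX _ (fun n => dense_setU_exterior (dY n)).
(* The preimage discards the points of [F n] in the exterior, and it stays finite because [set_val]
   is injective. *)
exists (fun n => Y n `&` set_val @^-1` F n); split => [n|G finG Gop].
  split; last by move=> a [].
  apply: (@sub_finite_set _ _ (set_val @^-1` F n)); first by move=> a [].
  apply: finite_preimage; last by have [] := FY n.
  by move=> a b _ _; exact: val_inj.
(* [h] fixes one ambient open set per open [V], so the test family below is an image of [G], hence
   finite; [set0] is a default value for non-open [V]. *)
have /choice[h hP] : forall V : set (set_type A), exists W : set X,
    open V -> open W /\ set_val @^-1` W = V.
  move=> V; have [[W Wop WV]|nV] := pselect (open V); first by exists W.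
  by exists set0.
have [|_ [V GV <-]|n Fn] := FG [set h V `&` (closure A)° | V in G].
- exact: finite_image.
- have [Vop [a Va]] := Gop V GV; have [hop hV] := hP V Vop.
  split; first by apply: openI => //; exact: open_interior.
  exists (set_val a); split; first by rewrite -hV in Va.
  exact/sA/set_valP.
- exists n => V GV; have [Vop _] := Gop V GV; have [_ hV] := hP V Vop.
  have [|x [[hx clx] Fx]] := Fn (h V `&` (closure A)°); first by exists V.
  (* Since [x] lies in [closure A], it is no added exterior point and must come from some [a] in
     [Y n]. *)
  have [_ /(_ x Fx) [[a Ya ax]|]] := FY n; last first.
    by move=> /(_ (interior_subset clx)).
  by exists a; split; [rewrite -hV /= ax | split => //=; rewrite ax].
Qed.

(* [set_type A] carries the subspace topology, induced by [set_val]. *)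
Theorem proposition3p5 (X : topologicalType)
    (X_tychonoff : tychonoff_space X) (X_Ssep : S_separable X) :
  (forall D : set X, dense D -> S_separable (set_type D)) /\
  (forall U : set X, open U -> S_separable (set_type U)).
Proof.
split=> [D dD|U Uop]; apply: S_separable_sub_interior_closure => //.
  have -> : closure D = setT.
    rewrite -subTset => x _ B; rewrite nbhsE => -[W [Wop Wx] WB].
    have [y [Wy Dy]] := dD W (ex_intro _ x Wx) Wop.
    by exists y; split => //; exact: WB.
  by rewrite interiorT.
(* An open set contained in [closure U] lies in its interior; apply this to [U] itself. *)
by rewrite -open_subsetE //; exact: subset_closure.
Qed.
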